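(* Let $0<\epsilon<1$ and $C>0$ be constants. There exist constants $c>0$ and $n_0$ (depending only on $\epsilon$ and $C$) such that the following holds for all integers $n\ge n_0$, $2\le\Delta\le n-1$ and $4\le k\le C n^{1-\epsilon}$: if there is a deterministic algorithm in the CONGEST$(B)$ model using $\lfloor (k-1)/2\rfloor$ rounds that solves the $k$-cycle membership problem on all $n$-node graphs of maximum degree at most $\Delta$, then $$B \;\geq\; c\,\log\left(\left(\frac{n-2}{2(\Delta-1)}\right)^{\Delta-1}\right).$$
   Context: CONGEST$(B)$ model (with $KT_1$ knowledge): the network is a simple undirected graph on $n$ nodes, each node having a unique ID in $[N]=\{1,\dots,N\}$, where $N\ge n$ is some polynomial in $n$. Initially each node knows its own ID and the IDs of its neighbors (and the global parameters such as $n$, $\Delta$, $k$, $N$), and nothing else about the graph. Computation proceeds in synchronous rounds; in each round each node sends a message of exactly $B$ bits ($B\ge 1$) to each of its neighbors (possibly different messages to different neighbors). The message sent in a round is a function of the initial knowledge of the node and the messages received in previous rounds; local computation is unbounded. After the last round each node produces an output determined by its initial knowledge and all messages it received. An algorithm solves a problem on a class of graphs if it is correct for every graph in the class and every assignment of distinct IDs from $[N]$. $k$-cycle membership problem: each node must output whether it is contained in a (simple) cycle of length $k$ of the graph. (The number $\lfloor (k-1)/2\rfloor$ is the optimal round complexity of this problem with unlimited bandwidth.) Logarithms are base 2. *)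

(* Defs.v *)
From mathcomp Require Import all_boot all_order all_algebra.
From mathcomp Require Import reals exp.

Set Implicit Arguments.
Unset Strict Implicit.
Unset Printing Implicit Defensive.

Definition log2 (R : realType) (x : R) : R := (ln x / ln 2)%R.

(* Identifiers: the ordinal i : 'I_N stands for the ID i+1 of [N] = {1,...,N}. *)

Definition message (B : nat) := B.-tuple bool.

(* What a node receives in one round, indexed by the ID of the sender; the
   entry is None at every ID that is not the ID of a neighbor. *)
Definition inbox (N B : nat) := {ffun 'I_N -> option (message B)}.

(* A deterministic CONGEST(B) algorithm with KT1 knowledge. The arguments of
   both functions are the own ID, the set of the IDs of the neighbors, and the
   inboxes of all previous rounds, oldest first (so its size tells the round);
   the last argument of [send] is the ID of the addressee. The global parameters
   are known because an algorithm is chosen after they are fixed; the functions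
   are arbitrary since local computation is unbounded. *)
Record algorithm (N B : nat) := Algorithm {
  send : 'I_N -> {set 'I_N} -> seq (inbox N B) -> 'I_N -> message B;
  output : 'I_N -> {set 'I_N} -> seq (inbox N B) -> bool
}.

Definition neighbors (V : finType) (e : rel V) (v : V) : {set V} :=
  [set u | e v u].

Section Execution.
Variables (N B : nat) (A : algorithm N B).
Variables (V : finType) (e : rel V) (id : V -> 'I_N).

Definition neighbor_ids (v : V) : {set 'I_N} := id @: neighbors e v.

(* The inbox of v, when [h u] is the history of u before the current round;
   for injective [id] at most one node u can be picked for each i. *)
Definition receive (h : V -> seq (inbox N B)) (v : V) : inbox N B :=
  [ffun i => omap (fun u => send A (id u) (neighbor_ids u) (h u) (id v))
                  [pick u in neighbors e v | id u == i]].

Fixpoint history (t : nat) (v : V) : seq (inbox N B) :=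
  if t is t'.+1 then rcons (history t' v) (receive (history t') v) else [::].

Definition node_output (T : nat) (v : V) : bool :=
  output A (id v) (neighbor_ids v) (history T v).

End Execution.

(* v lies on a simple cycle of length k. This is the graph-theoretic notion only
   for k >= 3, because an edge traversed back and forth is a [ucycle] of size 2. *)
Definition in_kcycle (V : finType) (e : rel V) (k : nat) (v : V) : bool :=
  [exists c : k.-tuple V, ucycleb e c && (v \in c)].

Definition simple_graph (V : finType) (e : rel V) : Prop :=
  symmetric e /\ irreflexive e.

Definition max_degree_at_most (V : finType) (e : rel V) (Delta : nat) : Prop :=
  forall v, #|neighbors e v| <= Delta.

Definition solves_kcycle_membership
    (n Delta k N B T : nat) (A : algorithm N B) : Prop :=
  forall (V : finType) (e : rel V) (id : V -> 'I_N),
    #|V| = n -> simple_graph e -> max_degree_at_most e Delta -> injective id ->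
    forall v : V, node_output A e id T v = in_kcycle e k v.

(* Main.v *)
Require Import Defs.
From mathcomp Require Import all_boot all_order all_algebra.
From mathcomp Require Import reals exp.
From mathcomp Require Import zify.

Set Implicit Arguments.
Unset Strict Implicit.
Unset Printing Implicit Defensive.

Import Order.TTheory GRing.Theory Num.Theory.

(** Attach two vertices a and b to the ends of a path with 2T - 1 vertices, where
    T = (k - 1) / 2 rounded down is the number of rounds, and give a and b further
    neighborhoods S and S'. The middle v of the path is at distance T from a and b,
    so its output depends on S and S' only through the first messages of a and b
    to the path.
    If k = 2T + 2, then v lies on a k-cycle iff S meets S', hence the message of a
    determines S.
    If k = 2T + 1, then v lies on a k-cycle iff a and b are adjacent. Here both a
    and b know the answer, but for every pair (a, b) the message of a has to reveal
    whether b is in S, or the message of b whether a is in S'; otherwise confusing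
    sets on both sides would fool v. By pigeonhole some vertex is responsible for
    almost half of the others, and its message determines any set of d of these.
    In both cases 2^B >= binomial(M, d) for all d < Delta and M about (n - k) / 2. *)

(** * Counting bounds and a fact about simple cycles *)

(** Induction through [(d+1) * 'C(M+1, d+1) = (M+1) * 'C(M, d)], since [(M+1)/(d+1) <= M/d] for
    [0 < d <= M]. *)
Lemma expn_leq_bin (M d : nat) : d <= M -> M ^ d <= 'C(M, d) * d ^ d.
Proof.
elim: d M => [|d IHd] [|M] // le_dM.
have [->|d_gt0] := posnP d; first by rewrite !expn1 bin1 muln1.
rewrite expnS [in leqRHS]expnS mulnA [_ * d.+1]mulnC -mul_bin_diag -mulnA.
rewrite leq_mul2l /= -(leq_pmul2r (m := d ^ d)) ?expn_gt0 ?d_gt0 //.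
apply: leq_trans (_ : (M * d.+1) ^ d <= _).
  by rewrite -expnMn leq_exp2r //; lia.
by rewrite expnMn mulnAC leq_mul2r IHd ?orbT.
Qed.

(** Every ordered pair of distinct points is charged to [a] by [L] or to [b] by [R]. So the
    [2 * #|U|] sets have total size at least [#|U| * (#|U| - 1)], too much if all have fewer than
    [M] elements. *)
Lemma pigeonhole_tournament (U : finType) (L R : rel U) (M : nat) :
  (forall a b, a != b -> L a b || R b a) ->
  M.*2 < #|U| ->
  exists a, (M <= #|[set b | b != a & L a b]|) || (M <= #|[set b | b != a & R a b]|).
Proof.
move=> LR ltM; apply/existsP; apply: contraLR ltM.
rewrite negb_exists => /forallP small; rewrite -leqNgt.
have [U0|U_gt0] := posnP #|U|; first by rewrite U0.
have cardE (P : rel U) a : #|[set b | b != a & P a b]| = \sum_(b | b != a) P a b.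
  by rewrite -sum1dep_card big_mkcondr; apply: eq_bigr => b _; case: (P a b).
have: #|U| * #|U|.-1 <= \sum_a (#|[set b | b != a & L a b]|
                                + #|[set b | b != a & R a b]|).
  under eq_bigr do rewrite !cardE.
  rewrite big_split /= (exchange_big_dep predT) //= -big_split /=.
  rewrite -sum_nat_const; apply: leq_sum => a _.
  rewrite (eq_bigl (fun b => b != a)) => [|b]; last by rewrite eq_sym.
  rewrite -big_split /=.
  rewrite -(cardC1 a) -sum1_card; apply: leq_sum => b /= ba.
  by have := LR b a ba; case: (L b a); case: (R a b).
move=> le_sum; have: #|U| * #|U|.-1 <= #|U| * M.*2.-2.
  apply: leq_trans le_sum _; rewrite -sum_nat_const; apply: leq_sum => a _.
  by move: (small a); rewrite negb_or -!ltnNge => /andP[/= lt1 lt2]; lia.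
have [a _] : exists a, a \in U by apply/card_gt0P.
by move: (small a); rewrite leq_pmul2l // negb_or -!ltnNge => /andP[lt1 _]; lia.
Qed.

(** Distinct sets of equal size are not nested, so [h] is injective on the [d]-subsets of [X]. *)
Lemma bin_leq_of_inj (U : finType) (B d : nat) (X : {set U})
    (h : {set U} -> message B) :
  (forall S S1 : {set U}, S \subset X -> S1 \subset X -> #|S| = d -> #|S1| = d ->
     forall b, b \in S -> b \notin S1 -> h S <> h S1) ->
  'C(#|X|, d) <= 2 ^ B.
Proof.
move=> h_sep; rewrite -cards_draws -[2]card_bool -card_tuple.
rewrite -(card_in_imset (f := h)) ?max_card // => S S1.
rewrite !inE => /andP[SX /eqP Sd] /andP[S1X /eqP S1d] eq_h.
apply/eqP; rewrite eqEcard Sd S1d leqnn andbT.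
by apply: contraT => /subsetPn[b bS bS1]; case: (h_sep S S1 SX S1X Sd S1d b bS bS1).
Qed.

(** Successor and predecessor of [x] differ on a simple cycle of length at least 3, so one of them
    is not [p]. *)
Lemma ucycle_other_neighbor (V : finType) (e : rel V) (c : seq V) (x p : V) :
  symmetric e -> ucycleb e c -> 2 < size c -> x \in c ->
  exists y, [/\ y \in c, e x y & y != p].
Proof.
move=> e_sym /andP[cyc uniqc] size_c xc.
have [np|] := eqVneq (next c x) p; last first.
  by exists (next c x); rewrite mem_next next_cycle.
exists (prev c x); rewrite mem_prev e_sym prev_cycle // -np; split=> //.
apply/eqP => eq_pn; have := next_prev uniqc x; rewrite eq_pn.
have [i c' defc] := rot_to xc; rewrite -!(next_rot i uniqc) defc.
have: uniq (x :: c') by rewrite -defc rot_uniq.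
have: 2 < size (x :: c') by rewrite -defc size_rot.
case: c' {defc} => [|y [|z c']] //= _ /andP[+ _].
rewrite !inE eqxx !negb_or => /and3P[xy xz _].
by rewrite eq_sym (negPf xy) eqxx => zx; rewrite zx eqxx in xz.
Qed.

(** * Locality of executions *)

Section Locality.
Variables (N B : nat) (A : algorithm N B) (V : finType) (id : V -> 'I_N).
Variables (e1 e2 : rel V) (Q : pred V) (rk : V -> nat) (T : nat).
(* [Q] is the region where the graphs agree; vertices outside are so far from those
   of rank 0 that only their first messages arrive in time. *)
Hypothesis Qnbr : forall x, Q x -> e1 x =1 e2 x.
Hypothesis Qrk : forall x y, Q x -> e1 x y ->
  if Q y then is_true (rk y <= (rk x).+1) else
    (rk x).+1 = T /\ send A (id y) (neighbor_ids e1 id y) [::] (id x)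
                = send A (id y) (neighbor_ids e2 id y) [::] (id x).

(** The rank grows by at most one along an edge inside [Q], so neighbors in [Q] satisfy the bound
    one round earlier. *)
Lemma eq_history (t : nat) (x : V) :
  Q x -> rk x + t <= T -> history A e1 id t x = history A e2 id t x.
Proof.
have nbrE y : Q y -> neighbors e1 y = neighbors e2 y.
  by move=> Qy; apply/setP => z; rewrite !inE Qnbr.
elim: t x => //= t IHt x Qx le_t; rewrite IHt //; last lia.
congr rcons; apply/ffunP => i; rewrite !ffunE -nbrE //.
case: pickP => //= y /andP[xy _]; congr Some.
move: xy; rewrite inE => /(Qrk Qx); case: ifP => [Qy le_y | _ [rkx send_eq]].
  by rewrite IHt //; [rewrite /neighbor_ids nbrE | lia].
(* A neighbor outside [Q] forces [rk x = T - 1], so this is the first round and its history is still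
   empty. *)
have -> : t = 0 by lia.
exact: send_eq.
Qed.

Lemma eq_node_output (x : V) :
  Q x -> rk x = 0 -> node_output A e1 id T x = node_output A e2 id T x.
Proof.
move=> Qx rkx; rewrite /node_output eq_history ?rkx // /neighbor_ids.
suff -> : neighbors e1 x = neighbors e2 x by [].
by apply/setP => z; rewrite !inE Qnbr.
Qed.

End Locality.

(** * The gadget graph and its cycles through the middle of the path *)

Section Gadget.
Variables (r m : nat) (a b : 'I_m).

(* [inl] is the path and [inr] the other vertices; in [gadget], vertex [a] hangs at
   the left end of the path and [b] at its right end. *)
Definition gadget (S S' : {set 'I_m}) : rel ('I_(r.*2.+1) + 'I_m) :=
  fun x y => match x, y with
  | inl i, inl j => (i.+1 == j) || (j.+1 == i)
  | inl i, inr u | inr u, inl i => (u == a) && (i == 0 :> nat) || (u == b) && (i == r.*2 :> nat)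
  | inr u, inr w => [|| (u == a) && (w \in S), (w == a) && (u \in S),
                        (u == b) && (w \in S') | (w == b) && (u \in S')]
  end.

(* The last condition says that S and S' agree on whether a and b are adjacent, so
   that the neighborhoods of a and b are given by S and S' exactly. *)
Definition admissible (S S' : {set 'I_m}) : Prop :=
  [/\ a != b, a \notin S, b \notin S' & (a \in S') = (b \in S)].

Definition left_nbrs (S : {set 'I_m}) : {set 'I_(r.*2.+1) + 'I_m} :=
  inl ord0 |: [set inr s | s in S].

Definition right_nbrs (S : {set 'I_m}) : {set 'I_(r.*2.+1) + 'I_m} :=
  inl ord_max |: [set inr s | s in S].

(* The path from a to b: [a] is at position 0 and [b] at every position past 2r+1. *)
Definition spine (t : nat) : 'I_(r.*2.+1) + 'I_m :=
  if t is t'.+1 then if t' <= r.*2 then inl (inord t') else inr b else inr a.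

Lemma spineS (i : 'I_(r.*2.+1)) : spine i.+1 = inl i.
Proof. by rewrite /= -ltnS ltn_ord inord_val. Qed.

Lemma spine_last : spine r.*2.+2 = inr b.
Proof. by rewrite /= ltnn. Qed.

Lemma inl_eq_spine (j : 'I_(r.*2.+1)) t : (inl j == spine t) = (j.+1 == t).
Proof.
case: t => [|t] //=; case: leqP => lt_t; last first.
  by symmetry; apply/negbTE; have := ltn_ord j; lia.
rewrite (inj_eq (_ : injective inl)) => [|? ? []//].
by rewrite -val_eqE /= inordK.
Qed.

Lemma inr_eq_spine u t :
  (inr u == spine t) = (t == 0) && (u == a) || (r.*2.+1 < t) && (u == b).
Proof.
have inrE (w : 'I_m) : ((inr u : 'I_(r.*2.+1) + 'I_m) == inr w) = (u == w).
  by rewrite (inj_eq (_ : injective inr)) // => ? ? [].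
by case: t => [|t] /=; rewrite ?orbF // !ltnS; case: leqP.
Qed.

Section Fixed.
Variables S S' : {set 'I_m}.
Hypothesis adm : admissible S S'.
Let e := gadget S S'.

Lemma gadget_sym : symmetric e.
Proof.
by move=> [i|u] [j|w] //=; rewrite 1?orbC // -!orbA; do !bool_congr; rewrite orbC.
Qed.

Lemma gadget_irr : irreflexive e.
Proof.
case: adm => ab aS bS' _ [i|u] /=; first by rewrite orbb gtn_eqF.
by apply/negP => /or4P[] /andP[/eqP->]; apply/negP.
Qed.

Lemma mem_inl_inr (i : 'I_(r.*2.+1)) (X : {set 'I_m}) :
  (inl i \in [set (inr s : 'I_(r.*2.+1) + 'I_m) | s in X]) = false.
Proof. by apply/negP => /imsetP[]. Qed.

Lemma mem_inr_inr (u : 'I_m) (X : {set 'I_m}) :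
  (inr u \in [set (inr s : 'I_(r.*2.+1) + 'I_m) | s in X]) = (u \in X).
Proof. by rewrite mem_imset // => ? ? []. Qed.

(** If [S'] joins [b] to [a], admissibility already puts [b] in [S]; hence the initial knowledge of
    [a] does not depend on [S']. *)
Lemma gadget_left : neighbors e (inr a) = left_nbrs S.
Proof.
case: adm => ab aS bS' abS; apply/setP => -[i|u]; rewrite !inE.
  by rewrite mem_inl_inr /= eqxx (negPf ab) !orbF.
rewrite mem_inr_inr /= eqxx (negPf ab) (negPf aS) andbF /= abS.
by case: eqP => [->|_]; rewrite /= ?orbb ?orbF.
Qed.

Lemma gadget_right : neighbors e (inr b) = right_nbrs S'.
Proof.
case: adm => ab aS bS' abS; apply/setP => -[i|u]; rewrite !inE.
  by rewrite mem_inl_inr /= eqxx [b == a]eq_sym (negPf ab) !orbF.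
rewrite mem_inr_inr /= eqxx [b == a]eq_sym (negPf ab) (negPf bS') andbF orbF /= -abS.
by case: eqP => [->|_]; rewrite /= ?orbb ?orbF.
Qed.

Lemma gadget_spine (i : 'I_(r.*2.+1)) y :
  e (inl i) y = (y == spine i) || (y == spine i.+2).
Proof.
case: y => [j|u]; rewrite ?inl_eq_spine ?inr_eq_spine //=; have := ltn_ord i.
  by move=> _; lia.
by move=> lt_i; case: (u == a); case: (u == b); lia.
Qed.

(** Degrees above 2 occur only at [a] and [b], where the strict bounds leave room for the edge to
    the path. *)
Lemma gadget_max_degree (Delta : nat) :
  2 <= Delta -> #|S| < Delta -> #|S'| < Delta -> max_degree_at_most e Delta.
Proof.
case: adm => ab aS bS' abS Delta2 S_lt S'_lt.
have inr_inj : injective (inr : 'I_m -> 'I_(r.*2.+1) + 'I_m) by move=> ? ? [].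
have card2 x y z : neighbors e x \subset [set y; z] -> #|neighbors e x| <= Delta.
  by move/subset_leq_card/leq_trans; apply; rewrite cards2; case: (_ != _) => //; exact: ltnW.
case=> [i|u].
  apply: (card2 _ (spine i) (spine i.+2)).
  by apply/subsetP => y; rewrite !inE gadget_spine.
have [->|ua] := eqVneq u a.
  by rewrite gadget_left cardsU1 mem_inl_inr card_imset.
have [->|ub] := eqVneq u b.
  by rewrite gadget_right cardsU1 mem_inl_inr card_imset.
apply: (card2 _ (inr a) (inr b)); apply/subsetP => -[i|w]; rewrite !inE /=.
  by rewrite (negPf ua) (negPf ub).
rewrite (negPf ua) (negPf ub) !(inj_eq inr_inj) /=.
by case/orP=> /andP[-> _]; rewrite ?orbT.
Qed.

Lemma spine_inj : {in [pred t | t < r.*2.+3] &, injective spine}.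
Proof.
case: adm => ab _ _ _ t u; rewrite !inE => lt_t lt_u /eqP.
case: u lt_u => [|u] lt_u; last have [le_u|gt_u] := leqP u r.*2.
- rewrite [spine 0]/= eq_sym inr_eq_spine eqxx (negPf ab) andbF orbF andbT.
  by move/eqP.
- have -> : spine u.+1 = inl (Ordinal (le_u : u < r.*2.+1)) by rewrite -spineS.
  by rewrite eq_sym inl_eq_spine eq_sym => /eqP.
have -> : u.+1 = r.*2.+2 by lia.
rewrite spine_last eq_sym inr_eq_spine [b == a]eq_sym (negPf ab) andbF eqxx andbT /=.
by lia.
Qed.

(** Path vertices have degree 2, so a cycle through the middle, at position [r + 1], is forced
    outward both ways up to [a] and [b]. *)
Lemma mem_spine_cycle c t :
  ucycleb e c -> 2 < size c -> inl (inord r) \in c -> t < r.*2.+3 ->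
  spine t \in c.
Proof.
move=> cyc size_c mid lt_t.
have nbrs u : 0 < u < r.*2.+2 -> spine u \in c -> spine u.-1 \in c /\ spine u.+1 \in c.
  case: u => // u /andP[_ lt_u]; rewrite (spineS (Ordinal (lt_u : u < r.*2.+1))).
  move=> uc; split.
    have [y [yc]] := ucycle_other_neighbor (spine u.+2) gadget_sym cyc size_c uc.
    by rewrite gadget_spine => /orP[/eqP<-|->].
  have [y [yc]] := ucycle_other_neighbor (spine u) gadget_sym cyc size_c uc.
  by rewrite gadget_spine => /orP[->|/eqP<-].
have mid' : spine r.+1 \in c by rewrite /= ifT //; lia.
have up u : r.+1 + u < r.*2.+3 -> spine (r.+1 + u) \in c.
  elim: u => [|u IHu] lt_u; first by rewrite addn0.
  rewrite addnS; apply: (nbrs _ _ (IHu _)).2; lia.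
have down u : u <= r.+1 -> spine (r.+1 - u) \in c.
  elim: u => [|u IHu] lt_u; first by rewrite subn0.
  rewrite subnS; apply: (nbrs _ _ (IHu _)).1; lia.
have [le_rt|lt_tr] := leqP r.+1 t; first by rewrite -(subnKC le_rt) up // subnKC.
by rewrite -(subKn (ltnW lt_tr)) down // leq_subr.
Qed.

Definition spine_seq := map spine (iota 0 r.*2.+3).

Lemma spine_seq_sub c :
  ucycleb e c -> 2 < size c -> inl (inord r) \in c -> {subset spine_seq <= c}.
Proof.
move=> cyc size_c mid x /mapP[t]; rewrite mem_iota => /andP[_ lt_t] ->.
exact: mem_spine_cycle.
Qed.

Lemma spine_seq_uniq : uniq spine_seq.
Proof.
rewrite map_inj_in_uniq ?iota_uniq // => t u; rewrite !mem_iota => lt_t lt_u.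
exact: spine_inj.
Qed.

Lemma spine_seq_path : path e (inr a) (behead spine_seq).
Proof.
have : sorted e spine_seq.
  apply/(sortedP (inr a)) => t; rewrite size_map size_iota => lt_t.
  rewrite !(nth_map 0) ?size_iota ?nth_iota //; try lia.
  case: t lt_t => [|t] lt_t; rewrite !add0n.
    by rewrite gadget_sym (spineS ord0) gadget_spine eqxx.
  rewrite (spineS (Ordinal (lt_t : t < r.*2.+1))).
  by rewrite gadget_spine eqxx orbT.
by [].
Qed.

Lemma spine_seq_last : last (inr a) (behead spine_seq) = inr b.
Proof.
rewrite -[inr a]/(spine 0) -[behead _]/(map spine (iota 1 r.*2.+2)) last_map.
by rewrite -nth_last size_iota nth_iota // spine_last.
Qed.

Lemma inr_spine_seq u : (inr u \in spine_seq) = (u == a) || (u == b).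
Proof.
apply/mapP/orP => [[t _ /eqP]|].
  by rewrite inr_eq_spine => /orP[] /andP[_ ->]; [left|right].
case=> /eqP->; [exists 0|exists r.*2.+2]; rewrite ?spine_last // mem_iota /=; lia.
Qed.

Lemma mid_spine_seq : inl (inord r) \in spine_seq.
Proof.
rewrite -[inl _](spineS) map_f // mem_iota inordK; lia.
Qed.

(** The [2r + 3] spine vertices fill the cycle, so only the edge between [a] and [b] can close
    it. *)
Lemma gadget_odd_cycle :
  in_kcycle e r.*2.+3 (inl (inord r)) = (b \in S).
Proof.
have [ab aS bS' abS] := adm.
apply/existsP/idP => [[c /andP[cyc vc]]|bS].
  have size_c : 2 < size c by rewrite size_tuple.
  have sub := spine_seq_sub cyc size_c vc.
  have [_ cE] : size c = size spine_seq /\ c =i spine_seq.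
    have := uniq_min_size spine_seq_uniq sub.
    rewrite size_tuple size_map size_iota => /(_ (leqnn _)) [eq_size eq_mem].
    by split=> // x; rewrite eq_mem.
  have ac : inr a \in c by rewrite cE inr_spine_seq eqxx.
  have [y [yc ay ny]] := ucycle_other_neighbor (inl ord0) gadget_sym cyc size_c ac.
  have : y \in neighbors e (inr a) by rewrite inE.
  rewrite gadget_left !inE (negPf ny) => /imsetP[s sS defy].
  move: yc; rewrite defy cE inr_spine_seq => /orP[]/eqP eq_s.
    by rewrite -eq_s sS in aS.
  by rewrite -eq_s.
have size_c : size spine_seq == r.*2.+3 by rewrite size_map size_iota.
exists (Tuple size_c).
change (cycle e (inr a :: behead spine_seq) && uniq spine_seq && (inl (inord r) \in spine_seq)).
rewrite spine_seq_uniq mid_spine_seq !andbT.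
change (path e (inr a) (rcons (behead spine_seq) (inr a))).
by rewrite rcons_path spine_seq_path spine_seq_last gadget_sym /= !eqxx bS.
Qed.

(** Exactly one vertex of the cycle is off the spine, and it has to be adjacent to both [a] and
    [b]. *)
Lemma gadget_even_cycle :
  b \notin S -> in_kcycle e r.*2.+4 (inl (inord r)) = (S :&: S' != set0).
Proof.
have [ab aS bS' abS] := adm => bS; rewrite (negPf bS) in abS.
apply/existsP/set0Pn => [[c /andP[cyc vc]]|[s]].
  have size_c : 2 < size c by rewrite size_tuple.
  have sub := spine_seq_sub cyc size_c vc.
  have ac : inr a \in c by apply: sub; rewrite inr_spine_seq eqxx.
  have bc : inr b \in c by apply: sub; rewrite inr_spine_seq eqxx orbT.
  have [y [yc ay ny]] := ucycle_other_neighbor (inl ord0) gadget_sym cyc size_c ac.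
  have [z [zc bz nz]] := ucycle_other_neighbor (inl ord_max) gadget_sym cyc size_c bc.
  have : y \in neighbors e (inr a) by rewrite inE.
  rewrite gadget_left !inE (negPf ny) => /imsetP[s sS defy].
  have : z \in neighbors e (inr b) by rewrite inE.
  rewrite gadget_right !inE (negPf nz) => /imsetP[s' sS' defz].
  have notin_spine u : u \in S -> inr u \notin spine_seq.
    by move=> uS; rewrite inr_spine_seq; apply/norP; split; apply: contraL uS => /eqP->.
  have notin_spine' u : u \in S' -> inr u \notin spine_seq.
    move=> uS; rewrite inr_spine_seq; apply/norP; split; apply: contraL uS => /eqP-> //.
    by rewrite abS.
  exists s; rewrite inE sS; have [-> //|ss'] := eqVneq s s'.
  (* Distinct [s] and [s'] would give the cycle at least [2r + 5] vertices. *)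
  have : uniq [:: inr s, inr s' & spine_seq].
    rewrite 2!cons_uniq in_cons negb_or notin_spine // notin_spine' // spine_seq_uniq !andbT.
    by apply: contra ss' => /eqP[->].
  move/uniq_leq_size => /(_ c).
  suff sub' : {subset [:: inr s, inr s' & spine_seq] <= c}.
    by move/(_ sub'); rewrite [size c]size_tuple /= size_map size_iota ltnn.
  by move=> x; rewrite !inE => /or3P[/eqP->|/eqP->|/sub]; rewrite -?defy -?defz.
rewrite inE => /andP[sS sS'].
have size_c : size (inr s :: spine_seq) == r.*2.+4 by rewrite /= size_map size_iota.
exists (Tuple size_c).
change (cycle e [:: inr s, inr a & behead spine_seq] && uniq (inr s :: spine_seq)
        && (inl (inord r) \in inr s :: spine_seq)).
rewrite in_cons mid_spine_seq orbT andbT cons_uniq spine_seq_uniq inr_spine_seq.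
change (e (inr s) (inr a) && path e (inr a) (rcons (behead spine_seq) (inr s))
        && (~~ ((s == a) || (s == b)) && true)).
rewrite rcons_path spine_seq_path spine_seq_last !andbT.
rewrite /= !eqxx (negPf ab) [b == a]eq_sym (negPf ab) sS sS' /=.
rewrite !orbT /=; apply/norP; split; apply: contraL sS => /eqP-> //.
Qed.

End Fixed.
End Gadget.

(** * Fooling pairs and the binomial bound on [B] *)

Lemma gadget_indistinguishable (N B r m : nat) (A : algorithm N B)
    (id : 'I_(r.*2.+1) + 'I_m -> 'I_N) (a b : 'I_m) (S S' S1 S1' : {set 'I_m}) :
  admissible a b S S' -> admissible a b S1 S1' ->
  send A (id (inr a)) (id @: left_nbrs r S) [::] (id (inl ord0)) =
    send A (id (inr a)) (id @: left_nbrs r S1) [::] (id (inl ord0)) ->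
  send A (id (inr b)) (id @: right_nbrs r S') [::] (id (inl ord_max)) =
    send A (id (inr b)) (id @: right_nbrs r S1') [::] (id (inl ord_max)) ->
  node_output A (gadget a b S S') id r.+1 (inl (inord r)) =
    node_output A (gadget a b S1 S1') id r.+1 (inl (inord r)).
Proof.
move=> adm adm1 eq_left eq_right.
(* On the path this is the distance to the middle, by truncated subtraction; at the ends it is [r],
   one less than the number of rounds. *)
pose rk (x : 'I_(r.*2.+1) + 'I_m) := if x is inl i then (i - r) + (r - i) else 0.
pose Q (x : 'I_(r.*2.+1) + 'I_m) := if x is inl _ then true else false.
apply: (@eq_node_output _ _ _ _ _ _ _ Q rk) => //.
- by case=> // i _ y; rewrite !gadget_spine.
- case=> // i [j|u] _ /=; first by rewrite /rk; lia.
  case/orP=> /andP[/eqP-> /eqP ei].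
    have -> : i = ord0 by apply: val_inj.
    by rewrite /neighbor_ids !gadget_left // eq_left /=; split=> //; lia.
  have -> : i = ord_max by apply: val_inj.
  by rewrite /neighbor_ids !gadget_right // eq_right /=; split=> //; lia.
by rewrite /rk inordK; lia.
Qed.

(** The message of [a] can hide whether [b] is a neighbor. The size bounds are strict because [a]
    has one more neighbor on the path. *)
Definition confuses (U : finType) (B Delta : nat) (h : U -> {set U} -> message B) : rel U :=
  fun a b => [exists S : {set U}, exists S1 : {set U},
    [&& #|S| < Delta, #|S1| < Delta, a \notin S, a \notin S1, b \in S, b \notin S1
      & h a S == h a S1]].

(** Two distinct [d]-subsets of these vertices with the same message would witness confusion about a
    vertex in their difference. *)
Lemma bin_leq_of_not_confuses (U : finType) (B Delta d M : nat)
    (h : U -> {set U} -> message B) (a : U) :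
  d < Delta -> M <= #|[set b | b != a & ~~ confuses Delta h a b]| -> 'C(M, d) <= 2 ^ B.
Proof.
move=> lt_d le_M; apply: leq_trans (leq_bin2l _ le_M) _.
apply: (bin_leq_of_inj (h := h a)) => S S1 SX S1X Sd S1d b bS bS1 eq_h.
have /subsetP/(_ _ bS) := SX; rewrite inE => /andP[_ /negP[]].
apply/existsP; exists S; apply/existsP; exists S1.
rewrite Sd S1d lt_d bS bS1 eq_h eqxx !andbT /=.
apply/andP; split; apply/negP.
  by move=> /(subsetP SX); rewrite inE eqxx.
by move=> /(subsetP S1X); rewrite inE eqxx.
Qed.

Lemma bin_leq_of_solves (n Delta k N B : nat) (A : algorithm N B) (d M : nat) :
  1 < Delta -> 3 < k -> n <= N -> 0 < d < Delta -> M.*2 + k <= n.+1 ->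
  solves_kcycle_membership n Delta k ((k - 1) %/ 2) A -> 'C(M, d) <= 2 ^ B.
Proof.
move=> Delta1 k3 le_nN /andP[d0 lt_d] le_Mn solA.
have [->|M0] := posnP M; first by rewrite bin0n; case: d d0 {lt_d}.
(* Then [k] is [2r + 3] or [2r + 4], there are [r + 1] rounds, and [m] vertices are left beside the
   path. *)
pose r := (k - 3) %/ 2; pose m := n - r.*2.+1.
have lt_Mm : M.*2 < m by rewrite /m /r; lia.
have cardV : #|{: 'I_(r.*2.+1) + 'I_m}| = n.
  by rewrite card_sum !card_ord /m /r; lia.
have le_VN : #|{: 'I_(r.*2.+1) + 'I_m}| <= N by rewrite cardV.
pose id v := widen_ord le_VN (enum_rank v).
have id_inj : injective id by move=> u v [/val_inj/enum_rank_inj].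
have eT : (k - 1) %/ 2 = r.+1 by rewrite /r; lia.
have solE (a b : 'I_m) S S' : admissible a b S S' -> #|S| < Delta -> #|S'| < Delta ->
    node_output A (gadget a b S S') id r.+1 (inl (inord r))
    = in_kcycle (gadget (r := r) a b S S') k (inl (inord r)).
  move=> adm S_lt S'_lt; rewrite -eT; apply: solA => //.
    by split; [exact: gadget_sym | exact: gadget_irr].
  exact: gadget_max_degree.
pose f a S := send A (id (inr a)) (id @: left_nbrs r S) [::] (id (inl ord0)).
pose g b S := send A (id (inr b)) (id @: right_nbrs r S) [::] (id (inl ord_max)).
have [ek|ek] : k = r.*2.+3 \/ k = r.*2.+4 by rewrite /r; lia.
  have lt_MU : M.*2 < #|'I_m| by rewrite card_ord.
  (* Confusion on both sides gives two indistinguishable gadgets, one with the edge between [a] and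
     [b] and one without. *)
  have LR (a b : 'I_m) : a != b -> ~~ confuses Delta f a b || ~~ confuses Delta g b a.
    move=> ab; rewrite -negb_and; apply/negP => /andP[].
    case/existsP=> S /existsP[S1 /and5P[cS cS1 aS aS1 /and3P[bS bS1 /eqP eq_f]]].
    case/existsP=> S' /existsP[S1' /and5P[cS' cS1' bS' bS1' /and3P[aS' aS1' /eqP eq_g]]].
    have adm : admissible a b S S' by split; rewrite ?aS' ?bS.
    have adm1 : admissible a b S1 S1' by split; rewrite ?(negPf aS1') ?(negPf bS1).
    have := gadget_indistinguishable adm adm1 eq_f eq_g.
    by rewrite !solE // ek !gadget_odd_cycle // bS (negPf bS1).
  have [a] := pigeonhole_tournament (L := fun a b => ~~ confuses Delta f a b)
    (R := fun a b => ~~ confuses Delta g a b) LR lt_MU.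
  by case/orP; apply: bin_leq_of_not_confuses.
have lt0m : 0 < m by lia.
have lt1m : 1 < m by lia.
pose a := Ordinal lt0m; pose b := Ordinal lt1m.
have le_M : M <= #|~: [set a; b]|.
  by have := cardsC [set a; b]; rewrite cards2 card_ord /=; lia.
apply: leq_trans (leq_bin2l _ le_M) _.
apply: (bin_leq_of_inj (h := f a)) => S S1 SX S1X Sd S1d s sS sS1 eq_f.
have nab u (X : {set 'I_m}) : u \in [set a; b] -> X \subset ~: [set a; b] -> u \notin X.
  by move=> uab /subsetP sub; apply: contraL uab => /sub; rewrite inE.
have aS := nab a _ (set21 _ _) SX; have aS1 := nab a _ (set21 _ _) S1X.
have bS := nab b _ (set22 _ _) SX; have bS1 := nab b _ (set22 _ _) S1X.
(* Giving [b] the neighborhood [[set s]] in both graphs makes its message the same, while only [S]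
   meets this set. *)
have sX : [set s] \subset ~: [set a; b] by rewrite sub1set (subsetP SX).
have as_ := nab a _ (set21 _ _) sX; have bs := nab b _ (set22 _ _) sX.
have adm : admissible a b S [set s] by split; rewrite // (negPf as_) (negPf bS).
have adm1 : admissible a b S1 [set s] by split; rewrite // (negPf as_) (negPf bS1).
have := gadget_indistinguishable adm adm1 eq_f erefl.
rewrite !solE ?Sd ?S1d ?cards1 // ek !gadget_even_cycle //.
have -> : S :&: [set s] = [set s] by apply/setIidPr; rewrite sub1set.
have -> : S1 :&: [set s] = set0.
  by apply/setP => u; rewrite !inE andbC; case: eqP => // ->; rewrite (negPf sS1).
rewrite eqxx => /negbFE/eqP/setP/(_ s).
by rewrite !inE eqxx.
Qed.

(** * Numerical estimates and the logarithmic bound *)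

(* Since M is only guaranteed to be n / 4, sets of size D may be too large for M;
   with d about D / 4, (M / d)^2 is at least (n - 2) / (2 D). *)
Lemma sqr_density_bound (n D M : nat) :
  16 < n -> 0 < D -> n <= 4 * M ->
  2 * D <= n - 2 -> (n - 2) * ((D + 3) %/ 4) ^ 2 <= 2 * D * M ^ 2.
Proof.
move=> n16 D0 le_nM le_Dn; set d := (_ %/ 4).
rewrite -(leq_pmul2l (_ : 0 < 16)) //.
have le_d : 4 * d <= D + 3 by rewrite /d; lia.
apply: leq_trans (_ : (n - 2) * (D + 3) ^ 2 <= _).
  have -> : 16 * ((n - 2) * d ^ 2) = (n - 2) * (4 * d) ^ 2 by rewrite expnMn; lia.
  by rewrite leq_mul2l leq_exp2r // le_d orbT.
apply: leq_trans (_ : 2 * D * n ^ 2 <= _); last first.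
  have -> : 16 * (2 * D * M ^ 2) = 2 * D * (4 * M) ^ 2 by rewrite expnMn; lia.
  by rewrite leq_mul2l leq_exp2r // le_nM orbT.
rewrite !expnS !expn0 !muln1.
(* The estimate [D + 3 <= 2 * D] used below needs [D >= 3]. *)
have [->|D1] := eqVneq D 1; first by nia.
have [->|D2] := eqVneq D 2; first by nia.
apply: leq_trans (_ : (n - 2) * ((2 * D) * (2 * D)) <= _).
  by rewrite leq_mul2l leq_mul ?orbT; lia.
have : (n - 2) * (2 * D) <= n * n by apply: leq_mul; lia.
nia.
Qed.

Lemma density_leq_of_solves (n Delta k N B : nat) (A : algorithm N B) :
  16 < n -> 1 < Delta -> 2 * (Delta - 1) <= n - 2 -> 3 < k -> 2 * k <= n -> n <= N ->
  solves_kcycle_membership n Delta k ((k - 1) %/ 2) A ->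
  exists d M, [/\ 0 < d, Delta - 1 <= 4 * d, M ^ d <= 2 ^ B * d ^ d
                & (n - 2) * d ^ 2 <= 2 * (Delta - 1) * M ^ 2].
Proof.
move=> n16 Delta1 le_Dn k3 k2n le_nN solA.
(* [d] is [(Delta - 1) / 4] rounded up, and [M] is the largest value with [2M + k <= n + 1];
   [2 * k <= n] gives [n <= 4 * M]. *)
exists ((Delta - 1 + 3) %/ 4), ((n.+1 - k) %/ 2); split; try lia; last first.
  by apply: sqr_density_bound => //; lia.
apply: leq_trans (expn_leq_bin (_ : _ <= _)) _; first lia.
by rewrite leq_mul2r (bin_leq_of_solves _ _ _ _ _ solA) ?orbT //; lia.
Qed.

Unset Implicit Arguments.
Local Open Scope ring_scope.

Theorem theorem6 (R : realType) (eps C : R) :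
  0 < eps -> eps < 1 -> 0 < C ->
  exists (c : R) (n0 : nat), 0 < c /\
    forall n Delta k N B : nat,
      (n0 <= n)%N ->
      (2 <= Delta)%N -> (Delta <= n - 1)%N ->
      (4 <= k)%N -> k%:R <= C * n%:R `^ (1 - eps) ->
      (n <= N)%N -> (1 <= B)%N ->
      (exists A : algorithm N B,
         solves_kcycle_membership n Delta k ((k - 1) %/ 2)%N A) ->
      c * log2 (((n%:R - 2) / (2 * (Delta%:R - 1))) ^+ (Delta - 1)) <= B%:R.
Proof.
move=> eps_gt0 eps_lt1 C_gt0.
(* The 8 comes from [x ^ (Delta - 1) <= x ^ (4d) <= (M / d) ^ (8d) <= 2 ^ (8B)] for [x > 1]. The
   second bound on [n] ensures [2C <= n ^ eps], hence [2k <= n]. *)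
exists (8%:R^-1), (maxn 17 (Num.trunc ((2 * C) `^ eps^-1)).+1).
split=> [|n Delta k N B]; first by rewrite invr_gt0.
rewrite geq_max => /andP[n17 n_large] Delta2 Delta_n k4 k_small le_nN _ [A solA].
have n_gt0 : 0 < n%:R :> R by rewrite ltr0n; apply: leq_trans n17.
have k2n : (2 * k <= n)%N.
  rewrite -(ler_nat R) natrM.
  have C_le : 2 * C <= n%:R `^ eps.
    have -> : 2 * C = (2 * C) `^ eps^-1 `^ eps.
      by rewrite -powRrM mulVf ?gt_eqF // powRr1 // ltW // mulr_gt0.
    apply: ge0_ler_powR; rewrite ?nnegrE ?powR_ge0 ?ltW //.
    by apply: lt_le_trans (truncnS_gt _) _; rewrite ler_nat.
  have -> : n%:R = n%:R `^ eps * n%:R `^ (1 - eps) :> R.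
    by rewrite -powRD ?subrKC ?powRr1 // ?ltW // (gt_eqF n_gt0) implybT.
  apply: le_trans (_ : 2 * (C * n%:R `^ (1 - eps)) <= _); first by rewrite ler_pM2l.
  by rewrite mulrA ler_wpM2r ?powR_ge0.
set x := (_ / _).
have Delta1_gt0 : 0 < 2 * (Delta%:R - 1) :> R.
  by rewrite mulr_gt0 // subr_gt0 ltr1n.
have x_gt0 : 0 < x by rewrite divr_gt0 // subr_gt0 ltr_nat; apply: leq_trans n17.
have ln2_gt0 : 0 < ln 2 :> R by rewrite ln_gt0 // ltr1n.
rewrite mulrC ler_pdivrMr ?ltr0n // /log2 ler_pdivrMr //.
(* For [x <= 1] the logarithm is not positive; [x > 1] yields [2 * (Delta - 1) <= n - 2] and allows
   raising the exponent to [4 * d]. *)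
have [x_le1|x_gt1] := leP x 1.
  apply: le_trans (_ : 0 <= _); last by rewrite !mulr_ge0 // ltW.
  by rewrite ln_le0 // exprn_ile1 // ltW.
have le_Dn : (2 * (Delta - 1) <= n - 2)%N.
  move: x_gt1; rewrite ltr_pdivlMr // mul1r -(natrB _ (ltnW Delta2)) -natrB; last by apply: leq_trans n17.
  by rewrite -natrM ltr_nat => /ltnW.
have [d [M [d_gt0 le_Dd le_Md le_nd]]] :=
  density_leq_of_solves n17 Delta2 le_Dn k4 k2n le_nN solA.
have le_pow : (M%:R / d%:R) ^+ d <= 2 ^+ B :> R.
  rewrite expr_div_n ler_pdivrMr ?exprn_gt0 ?ltr0n // -!natrX -natrM ler_nat.
  exact: le_Md.
have le_x : x <= (M%:R / d%:R) ^+ 2.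
  rewrite expr_div_n ler_pdivlMr ?exprn_gt0 ?ltr0n // mulrAC ler_pdivrMr //.
  rewrite -(natrB _ (ltnW Delta2)) -natrB; last by apply: leq_trans n17.
  by rewrite -!natrX -!natrM ler_nat [leqRHS]mulnC.
have Md_ge0 : 0 <= M%:R / d%:R :> R by rewrite divr_ge0.
rewrite -natrM mulr_natl -lnXn // ler_ln ?posrE ?exprn_gt0 //.
apply: le_trans (_ : x ^+ (4 * d) <= _).
  by apply: ler_weXn2l; rewrite // ltW.
apply: le_trans (_ : ((M%:R / d%:R) ^+ d) ^+ 8 <= _); last first.
  by rewrite exprM lerXn2r ?nnegrE ?exprn_ge0.
have -> : ((M%:R / d%:R) ^+ d) ^+ 8 = ((M%:R / d%:R) ^+ 2) ^+ (4 * d) :> R.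
  by rewrite -!exprM mulnA mulnC.
by rewrite lerXn2r ?nnegrE ?exprn_ge0 // ltW.
Qed.
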